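(* For each integer $i \ge 2$, the limit $\lim_{n\to\infty} a(n,i)$ exists and $$\lim_{n \to \infty} a(n,i) = \frac{6\, h_{i-1}}{\pi^2 (i-1)} .$$
   Context: Write $h_n := \sum_{i=1}^n \frac1i$. The harmonic descent (HD) chain is the discrete-time Markov chain $(X_t,\ t=0,1,2,\ldots)$ on the states $\{1,2,3,\ldots\}$ with transition probabilities $$p(j,i) = \frac{1}{(j-i)\,h_{j-1}}, \quad 1 \le i < j,\ j \ge 2,$$ and $p(1,1)=1$ (all other transition probabilities are $0$). For integers $1\le i\le n$, $a(n,i)$ denotes the probability that the chain started at state $n$ is ever in state $i$ (so $a(n,n)=a(n,1)=1$). *)

(* Defs.v *)
From mathcomp Require Import all_boot all_order all_algebra.
From mathcomp Require Import all_classical all_reals all_analysis.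
Set Implicit Arguments.
Unset Strict Implicit.
Unset Printing Implicit Defensive.
Import Order.TTheory GRing.Theory Num.Theory.
Import numFieldNormedType.Exports.
Local Open Scope classical_set_scope.
Local Open Scope ring_scope.

Definition harm {R : realType} (n : nat) : R :=
  \sum_(1 <= k < n.+1) k%:R^-1.

(* The states are the positive integers; the values at j = 0 are junk. *)
Definition HD_trans {R : realType} (j i : nat) : R :=
  if j == 1%N then (i == 1%N)%:R
  else if (1 <= i < j)%N then ((j - i)%:R * harm j.-1)^-1
  else 0.

Section MarkovChain.
Context {R : realType} {d : measure_display} {T : measurableType d}.
Variable P : probability T R.

(* Only meaningful when P B != 0. *)
Definition cond_prob (A B : set T) : R := fine (P (A `&` B)) / fine (P B).

(* The event X_0 = x_0, ..., X_t = x_t. *)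
Definition path_event (X : nat -> T -> nat) (x : nat -> nat) (t : nat) :
    set T := [set w | forall s : nat, (s <= t)%N -> X s w = x s].

(* X is a time-homogeneous discrete-time Markov chain on {1, 2, 3, ...} with
   transition probabilities p, started at state n. *)
Record markov_chain (p : nat -> nat -> R) (n : nat)
    (X : nat -> {RV P >-> nat}) : Prop := MarkovChain {
  mc_state : forall t w, (0 < X t w)%N ;
  mc_start : P [set w | X 0%N w = n] = 1%E ;
  mc_step : forall (t : nat) (x : nat -> nat) (y : nat),
    P (path_event X x t) != 0%E ->
    cond_prob [set w | X t.+1 w = y] (path_event X x t) = p (x t) y }.

Definition hit_prob (X : nat -> T -> nat) (i : nat) : R :=
  fine (P [set w | exists t, X t w = i]).

End MarkovChain.

(* Main.v *)
Require Import Defs.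
From mathcomp Require Import all_boot all_order all_algebra.
From mathcomp Require Import all_classical all_reals all_analysis.
From mathcomp Require Import ring lra zify.
Import Order.TTheory GRing.Theory Num.Theory.
Import numFieldNormedType.Exports.
Local Open Scope classical_set_scope.
Local Open Scope ring_scope.

(* Fix i and put u_n = a(n,i). First-step analysis says that u is averaging:
   sum_(k<n) (u_n - u_k) / (n-k) = 0 for n > i. Since
   b(n) = h_(n-1) / (n-1) is a stationary measure, the flux of u through n,
   sum_(k<=n) w_n(k) u_k with w_n(k) = sum_(m>n) b(m) p(m,k), is independent of
   n >= i and equals b(i), while the flux of the constant 1 tends to zeta(2).
   The weights satisfy w_n(k) <= 1/(n-k), so where u_n + eps h_(n-1) attains a
   new maximum the averaging identity forces zeta(2) u_n <= b(i) + eps zeta(2),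
   approximately. Such records exist arbitrarily far and dominate all earlier
   values of u, so limsup u_n <= b(i) / zeta(2); applying this to -u gives the
   lower bound. Finally zeta(2) = pi^2/6 follows from repeated use of
   1/sin^2 x + 1/cos^2 x = 4/sin^2 (2x) and sin x <= x <= tan x. *)

(** * Harmonic numbers and the flux *)

Lemma harm0 (R : realType) : harm 0 = 0 :> R.
Proof. by rewrite /harm big_geq. Qed.

Lemma harmS (R : realType) (n : nat) : harm n.+1 = harm n + n.+1%:R^-1 :> R.
Proof. by rewrite /harm big_nat_recr. Qed.

Lemma harm_mono (R : realType) : {homo @harm R : m n / (m <= n)%N >-> m <= n}.
Proof.
apply: homo_leq => [//|y x z|n]; first exact: le_trans.
by rewrite harmS lerDl invr_ge0.
Qed.

Lemma harm_gt0 (R : realType) (n : nat) : (0 < n)%N -> 0 < harm n :> R.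
Proof.
move=> n0; apply: (@lt_le_trans _ _ (harm 1)); last exact: harm_mono.
by rewrite harmS harm0 add0r invr1.
Qed.

Lemma harm_rev (R : realType) (n : nat) :
  \sum_(1 <= k < n.+1) (n.+1 - k)%:R^-1 = harm n :> R.
Proof.
rewrite /harm big_nat_rev big_nat [RHS]big_nat; apply: eq_bigr => r rn.
by congr (_%:R^-1); lia.
Qed.

Definition inv_sq_sum {R : realType} (n : nat) : R :=
  \sum_(1 <= k < n.+1) k%:R ^- 2.

Lemma inv_sq_sumS (R : realType) (n : nat) :
  inv_sq_sum n.+1 = inv_sq_sum n + n.+1%:R ^- 2 :> R.
Proof. by rewrite /inv_sq_sum big_nat_recr. Qed.

(* States are shifted by one: [r] stands for the state [r.+1]. The measure
   [b m = harm m / m] is stationary, and [flux_weight n r] is the total mass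
   [\sum_(m > n) b m * HD_trans m.+1 r.+1] that it sends from above [n] to [r],
   i.e. the sum over [m > n] of [1 / (m * (m - r))], in closed form. *)
Definition flux_weight {R : realType} (n r : nat) : R :=
  (harm n - harm (n - r)) / r%:R.

Definition flux {R : realType} (v : nat -> R) (n : nat) : R :=
  \sum_(1 <= r < n.+1) flux_weight n r * v r.

Lemma flux_weight_ge0 (R : realType) (n r : nat) :
  0 <= flux_weight n r :> R.
Proof. by rewrite divr_ge0 // subr_ge0 harm_mono // leq_subr. Qed.

(** The difference [harm n - harm (n - r)] has [r] terms, each at most [1 / (n - r)]. *)
Lemma flux_weight_le (R : realType) (n r : nat) : (0 < r < n)%N ->
  flux_weight n r <= (n - r)%:R^-1 :> R.
Proof.
move=> /andP[r0 rn]; rewrite ler_pdivrMr ?ltr0n // lerBlDl.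
have /(_ r) : forall k,
    harm (n - r + k) <= harm (n - r) + (n - r)%:R^-1 * k%:R :> R.
  elim=> [|k IH]; first by rewrite addn0 mulr0 addr0.
  rewrite addnS harmS -[k.+1%:R]natr1 mulrDr mulr1 addrA lerD //.
  by rewrite lef_pV2 ?posrE ?ltr0n ?subn_gt0 // ler_nat; lia.
by rewrite subnK // ltnW.
Qed.

(** In the series over [m > n] of [1 / (m * (m - r))] the term [m = n + 1] is dropped; on the closed
    form this is a partial fraction identity. *)
Lemma flux_weightS (R : realType) (n r : nat) : (0 < r <= n)%N ->
  flux_weight n.+1 r =
    flux_weight n r - (n.+1%:R * (n.+1 - r)%:R)^-1 :> R.
Proof.
move=> /andP[r0 rn]; rewrite /flux_weight subSn // !harmS.
have -> : n.+1%:R = (n - r).+1%:R + r%:R :> R.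
  by rewrite -natrD; congr (_%:R); lia.
have p0 : (n - r).+1%:R != 0 :> R by rewrite pnatr_eq0.
have r0' : r%:R != 0 :> R by rewrite pnatr_eq0 -lt0n.
have pr : (n - r).+1%:R + r%:R != 0 :> R by rewrite -natrD pnatr_eq0.
move: (harm _) (harm _) (n - r).+1%:R r%:R p0 r0' pr => x y a b a0 b0 ab.
by field; rewrite a0 b0 ab.
Qed.

(** The bracket vanishes when [v] averages at [n + 1] and [v 0 = 0]; this is how the flux is
    conserved. *)
Lemma fluxS (R : realType) (v : nat -> R) (n : nat) :
  flux v n.+1 = flux v n + n.+1%:R^-1 *
    (harm n.+1 * v n.+1 - \sum_(1 <= r < n.+1) v r / (n.+1 - r)%:R).
Proof.
rewrite /flux big_nat_recr //= {2}/flux_weight subnn harm0 subr0.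
rewrite (@eq_big_nat _ _ _ _ _ _ (fun r => flux_weight n r * v r -
    n.+1%:R^-1 * (v r / (n.+1 - r)%:R))); last first.
  by move=> r rn; rewrite flux_weightS //= invfM; ring.
by rewrite sumrB -mulr_sumr; ring.
Qed.

Lemma flux_cst1 (R : realType) (n : nat) :
  flux (fun=> 1) n = inv_sq_sum n :> R.
Proof.
elim: n => [|n IH]; first by rewrite /flux /inv_sq_sum !big_geq.
rewrite fluxS IH inv_sq_sumS; congr (_ + _).
have -> : \sum_(1 <= r < n.+1) 1 / (n.+1 - r)%:R = harm n :> R.
  by rewrite -harm_rev; apply: eq_bigr => r _; rewrite div1r.
by rewrite harmS mulr1 addrC addrA addNr add0r expr2 invfM.
Qed.

(** Reversing the order of summation gives the flux of the constant 1. This evaluates the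
    [eps * harm] part in [flux_record]. *)
Lemma sum_harm_diff (R : realType) (n : nat) :
  \sum_(0 <= y < n) (harm n - harm y) / (n - y)%:R = inv_sq_sum n :> R.
Proof.
rewrite -flux_cst1 /flux big_add1 /= big_nat_rev big_nat [RHS]big_nat.
apply: eq_bigr => r rn; rewrite mulr1 /flux_weight.
by congr ((_ - harm _) / _%:R); lia.
Qed.

Lemma inv_sq_sum_gt0 (R : realType) (n : nat) :
  (0 < n)%N -> 0 < inv_sq_sum n :> R.
Proof.
case: n => // n _; rewrite /inv_sq_sum big_nat_recr //= ltr_wpDl //.
by apply: sumr_ge0 => k _; rewrite invr_ge0 exprn_ge0.
Qed.

(* At a record [n] of [v + eps * harm] the averaging identity makes all the
   differences [v n - v r] small in the weights [1 / (n - r)], which dominate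
   the flux weights. *)
Lemma flux_record (R : realType) (v : nat -> R) (B eps : R) (n : nat) :
  0 <= eps -> flux v n = B ->
  \sum_(0 <= y < n) (v n - v y) / (n - y)%:R = 0 ->
  (forall k, (k <= n)%N -> v k + eps * harm k <= v n + eps * harm n) ->
  v n * inv_sq_sum n <= B + eps * inv_sq_sum n.
Proof.
move=> eps0 vB avg rec; pose g r := v n - v r + eps * (harm n - harm r).
have g0 r : (r <= n)%N -> 0 <= g r by move=> /rec; rewrite /g; lra.
have -> : v n * inv_sq_sum n = B + flux (fun r => v n - v r) n.
  rewrite -vB -flux_cst1 /flux mulr_sumr -big_split /=.
  by apply: eq_bigr => r _; ring.
rewrite lerD2l.
(* By [avg] the [v] part of [g] contributes 0, so only the harmonic part is left. *)
have -> : eps * inv_sq_sum n = \sum_(0 <= y < n) g y / (n - y)%:R.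
  rewrite -sum_harm_diff mulr_sumr -[LHS]add0r -{1}avg -big_split /=.
  by apply: eq_bigr => r _; rewrite /g; ring.
case: n @g g0 {vB avg rec} => [|n] g g0; first by rewrite /flux !big_geq.
(* The last flux term is 0 and the term [y = 0] on the right is nonnegative; the remaining indices
   are compared term by term. *)
rewrite /flux big_nat_recr //= subrr mulr0 addr0 [leRHS]big_ltn //.
rewrite ler_wpDl ?divr_ge0 ?g0 // big_nat [leRHS]big_nat.
apply: ler_sum => r /andP[r1 rn].
(* [v n - v r] may be negative, so it is raised to [g r] before the weight is enlarged. *)
apply: (@le_trans _ _ (flux_weight n.+1 r * g r)).
  rewrite ler_wpM2l ?flux_weight_ge0 // /g lerDl mulr_ge0 // subr_ge0.
  by rewrite harm_mono // ltnW.
by rewrite mulrC ler_wpM2l ?g0 ?(ltnW rn) // flux_weight_le // r1.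
Qed.

Lemma harm_cvgy (R : realType) : @harm R @ \oo --> +oo.
Proof.
have -> : @harm R = series harmonic.
  by apply/funext => n; rewrite /harm /series /= big_add1.
apply: nondecreasing_dvgn_lt; last exact: dvg_harmonic.
by apply/nondecreasing_series => k _ _; exact: harmonic_ge0.
Qed.

Lemma flux_limsup (R : realType) (v : nat -> R) (B z : R) (x0 : nat) :
  @inv_sq_sum R @ \oo --> z -> 0 < z ->
  (exists C, forall x, `|v x| <= C) ->
  (forall x, (x0 <= x)%N -> flux v x = B) ->
  (forall x, (x0 < x)%N -> \sum_(0 <= y < x) (v x - v y) / (x - y)%:R = 0) ->
  forall eps, 0 < eps -> \forall m \near \oo, v m <= B / z + eps.
Proof.
move=> sz z0 [C vC] vB avg eps eps0; pose e := eps / 2.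
have e0 : 0 < e by rewrite divr_gt0.
have [N _ HN] : \forall n \near \oo, B / inv_sq_sum n <= B / z + e.
  have cv : B / inv_sq_sum n @[n --> \oo] --> B / z.
    by apply: cvgM; [exact: cvg_cst | apply: cvgV; rewrite ?gt_eqF].
  have /cvgrPdist_le/(_ e e0) := cv; apply: filterS => n.
  by rewrite ler_norml => /andP[]; lra.
pose K := maxn x0 N.
(* For [m >= M], [v m + e * harm m >= - C + e * harm m] exceeds [C + e * harm K], a bound for
   [v + e * harm] on [[0, K]]. Hence the maximiser [n] below lies beyond [K]. *)
have /cvgryPgt/(_ ((C + e * harm K + C) / e)) [M _ HM] := @harm_cvgy R.
exists M => // m /HM /=; rewrite ltr_pdivrMr // => hm.
pose f k := v k + e * harm k.
pose n := [arg max_(k > (ord0 : 'I_m.+1)) f k]%O.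
have fn k : (k <= m)%N -> f k <= f n.
  rewrite /n => km; case: arg_maxP => // j _.
  by move=> /(_ (Ordinal (km : (k < m.+1)%N)) isT); exact.
have nm : (n <= m)%N by rewrite -ltnS ltn_ord.
have Kn : (K < n)%N.
  rewrite ltnNge; apply/negP => nK.
  have := fn m (leqnn m); have := vC m; have := vC n; rewrite /f !ler_norml.
  have : e * harm n <= e * harm K by rewrite ler_pM2l ?harm_mono.
  by move: hm; rewrite [harm m * _]mulrC => ? ? /andP[? ?] /andP[? ?]; lra.
have x0n : (x0 < n)%N by apply: leq_ltn_trans Kn; rewrite leq_maxl.
have Nn : (N <= n)%N by apply: ltnW; apply: leq_ltn_trans Kn; rewrite leq_maxr.
have sn : 0 < inv_sq_sum n :> R.
  by rewrite inv_sq_sum_gt0 // (leq_ltn_trans _ x0n).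
have := flux_record R v B e n (ltW e0) (vB n (ltnW x0n)) (avg n x0n)
  (fun k kn => fn k (leq_trans kn nm)).
rewrite -ler_pdivlMr // mulrDl mulfK ?gt_eqF // => vn.
(* Since [n <= m], [f m <= f n] gives [v m <= v n], and [v n <= B / inv_sq_sum n + e <= B / z +
   2e]. *)
have := fn m (leqnn m); have := HN n Nn; rewrite /= /f.
have : e * harm n <= e * harm m by rewrite ler_pM2l ?harm_mono.
rewrite [eps](_ : _ = e + e) ?addrA; last by rewrite /e; field.
by lra.
Qed.

Lemma flux_cvg (R : realType) (v : nat -> R) (B z : R) (x0 : nat) :
  @inv_sq_sum R @ \oo --> z -> 0 < z ->
  (exists C, forall x, `|v x| <= C) ->
  (forall x, (x0 <= x)%N -> flux v x = B) ->
  (forall x, (x0 < x)%N -> \sum_(0 <= y < x) (v x - v y) / (x - y)%:R = 0) ->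
  v @ \oo --> B / z.
Proof.
move=> sz z0 [C vC] vB avg; apply/cvgrPdist_le => eps eps0.
have up := flux_limsup R v B z x0 sz z0 (ex_intro _ C vC) vB avg eps eps0.
have lo : \forall m \near \oo, - v m <= - B / z + eps.
  apply: (flux_limsup _ (fun x => - v x) _ _ x0) => //.
  - by exists C => x; rewrite normrN.
  - move=> x /vB <-; rewrite /flux -sumrN.
    by apply: eq_bigr => r _; rewrite mulrN.
  - move=> x /avg /eqP; rewrite -oppr_eq0 -sumrN => /eqP {2}<-.
    by apply: eq_bigr => y _; rewrite -mulNr; congr (_ / _); ring.
near=> m; rewrite ler_norml; apply/andP; split.
  by rewrite lerBrDl -lerBrDr opprK; near: m.
have : - v m <= - B / z + eps by near: m.
by rewrite mulNr; lra.
Unshelve. all: by end_near. Qed.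

(** * The value of zeta(2) *)

Lemma sin_le_id (R : realType) (x : R) : 0 < x -> x < pi / 2 -> sin x <= x.
Proof.
move=> x0 xp.
have [z|y _] := @MVT R sin cos 0 x x0 (fun z _ => is_derive_sin z).
  exact/continuous_subspaceT/continuous_sin.
by rewrite sin0 !subr0 => ->; rewrite ler_piMl ?(ltW x0) // cos_le1.
Qed.

Lemma id_le_tan (R : realType) (x : R) : 0 < x -> x < pi / 2 -> x <= tan x.
Proof.
move=> x0 xp; have p2 : 0 < pi / 2 :> R by rewrite divr_gt0 ?pi_gt0.
have c0 z : z \in `[0, x] -> 0 < cos z.
  rewrite in_itv /= => /andP[z0 zx]; apply: cos_gt0_pihalf.
  by rewrite (lt_le_trans _ z0) ?oppr_lt0 //= (le_lt_trans zx).
have [z zx||y yx] := @MVT R tan (fun z => (cos z)^-2) 0 x x0.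
- by apply: is_derive_tan; rewrite gt_eqF // c0 // (subset_itv_oo_cc zx).
- apply/continuous_in_subspaceT => z; rewrite mem_setE => zx.
  by apply: continuous_tan; rewrite gt_eqF // c0.
rewrite tan0 !subr0 => ->; rewrite ler_peMl ?(ltW x0) //.
have cy := c0 y (subset_itv_oo_cc yx).
by rewrite invf_ge1 ?exprn_gt0 // expr_le1 ?cos_le1 // ltW.
Qed.

(** Combines [sin x <= x <= tan x] with [1 / sin^2 = 1 / tan^2 + 1]. *)
Lemma inv_sq_sin_bounds (R : realType) (x : R) : 0 < x -> x < pi / 2 ->
  x ^- 2 <= sin x ^- 2 <= x ^- 2 + 1.
Proof.
move=> x0 xp; have s0 : 0 < sin x by apply: sin_gt0_pihalf; rewrite x0.
have c0 : 0 < cos x.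
  apply: cos_gt0_pihalf.
  by rewrite xp (lt_trans _ x0) ?oppr_lt0 ?divr_gt0 ?pi_gt0.
apply/andP; split.
  by rewrite lef_pV2 ?posrE ?exprn_gt0 // lerXn2r ?nnegrE ?sin_le_id ?ltW.
have t0 : 0 < tan x by rewrite divr_gt0.
have -> : sin x ^- 2 = tan x ^- 2 + 1.
  have := cos2Dsin2 x; rewrite /tan => e.
  have -> : (sin x / cos x) ^- 2 = cos x ^+ 2 / sin x ^+ 2.
    by rewrite expr_div_n invf_div.
  rewrite -[X in _ = _ + X](@divff _ (sin x ^+ 2)) ?sqrf_eq0 ?gt_eqF //.
  by rewrite -mulrDl e div1r.
by rewrite lerD2r lef_pV2 ?posrE ?exprn_gt0 // lerXn2r ?nnegrE ?id_le_tan ?ltW.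
Qed.

(** The second term is [1 / cos^2 x], written as a sine so that it can be another term of the sum in
    [sum_inv_sq_sin]. *)
Lemma inv_sq_sin_double (R : realType) (x : R) : 0 < x -> x < pi / 2 ->
  sin x ^- 2 + sin (pi / 2 - x) ^- 2 = 4 * sin (x *+ 2) ^- 2.
Proof.
move=> x0 xp; have s0 : 0 < sin x by apply: sin_gt0_pihalf; rewrite x0.
have c0 : 0 < cos x.
  apply: cos_gt0_pihalf.
  by rewrite xp (lt_trans _ x0) ?oppr_lt0 ?divr_gt0 ?pi_gt0.
rewrite sinB sin_pihalf cos_pihalf mul1r mul0r subr0 sin_mulr2n.
have -> : 4 * (cos x * sin x *+ 2) ^- 2 = (cos x ^+ 2 * sin x ^+ 2)^-1.
  by field; rewrite !gt_eqF.
by rewrite -[in RHS](div1r (_ * _)) -(cos2Dsin2 x); field; rewrite !gt_eqF.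
Qed.

Lemma sum_pair_sym (V : nmodType) (F : nat -> V) (m : nat) :
  \sum_(0 <= k < m + m) F k = \sum_(0 <= k < m) (F k + F (m + m - k.+1)%N).
Proof.
rewrite (@big_cat_nat _ _ _ m) ?leq_addr //= big_split /=; congr (_ + _).
rewrite -{1}[m]add0n big_addn addnK big_nat_rev big_nat [RHS]big_nat.
by apply: eq_bigr => k km; congr F; lia.
Qed.

(** Induction on [n], with [m = 2^n]: at level [n + 1] the terms [k] and [2m - 1 - k] have
    complementary angles, so the doubling identity merges them into 4 times the term [k] of level
    [n]. *)
Lemma sum_inv_sq_sin (R : realType) (n : nat) :
  \sum_(0 <= k < 2 ^ n) sin (k.*2.+1%:R * (pi / (4 * (2 ^ n)%:R))) ^- 2
    = 2 * (2 ^ n)%:R ^+ 2 :> R.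
Proof.
have p2 : 0 < pi / 2 :> R by rewrite divr_gt0 ?pi_gt0.
elim: n => [|n IH].
  rewrite expn0 big_nat1 mulr1 mul1r expr1n mulr1.
  (* [pi / 4] is its own complement, so the doubling identity determines the single term. *)
  have /inv_sq_sin_double : 0 < pi / 4 :> R by rewrite divr_gt0 ?pi_gt0.
  have -> : pi / 2 - pi / 4 = pi / 4 :> R by field.
  have -> : pi / 4 *+ 2 = pi / 2 :> R by field.
  by rewrite sin_pihalf expr1n invr1 => e; have := e ltac:(lra); lra.
have -> : (2 ^ n.+1 = 2 ^ n + 2 ^ n)%N by rewrite expnS mul2n addnn.
move: (2 ^ n)%N (expn_gt0 2 n) IH => m m0 IH.
have m0R : 0 < m%:R :> R by rewrite ltr0n.
have mm : (m + m)%:R = 2 * m%:R :> R by rewrite natrD; ring.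
have -> : 2 * (m + m)%:R ^+ 2 = 4 * (2 * m%:R ^+ 2) :> R by rewrite mm; ring.
rewrite sum_pair_sym -IH mulr_sumr big_nat [RHS]big_nat.
apply: eq_bigr => k /= km; set a := _ / _; set b := pi / (4 * m%:R).
have ab : b = a *+ 2 by rewrite /a /b mm; field; rewrite gt_eqF.
have a0 : 0 < a by rewrite divr_gt0 ?pi_gt0 // mulr_gt0 // ltr0n addn_gt0 m0.
have am : (m + m).*2%:R * a = pi / 2.
  by rewrite /a -muln2 natrM mm; field; rewrite gt_eqF.
have -> : (m + m - k.+1).*2.+1%:R * a = pi / 2 - k.*2.+1%:R * a.
  by rewrite -am -mulrBl -natrB; [congr (_%:R * _)|]; lia.
have ka0 : 0 < k.*2.+1%:R * a by rewrite mulr_gt0.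
have kap : k.*2.+1%:R * a < pi / 2 by rewrite -am ltr_pM2r // ltr_nat; lia.
by rewrite inv_sq_sin_double // ab mulrnAr.
Qed.

Definition odd_inv_sq_sum {R : realType} (n : nat) : R :=
  \sum_(0 <= k < n) k.*2.+1%:R ^- 2.

(** Each term of [sum_inv_sq_sin] is bounded by [inv_sq_sin_bounds]. With [m = 2^n], multiplying by
    the square of [a = pi / (4m)] turns the value [2 m^2] into [pi^2 / 8] and the error [m] into
    [pi^2 / (16 m)]. *)
Lemma odd_inv_sq_sum_bounds (R : realType) (n : nat) :
  pi ^+ 2 / 8 - pi ^+ 2 / 16 * (2 ^ n)%:R^-1 <= @odd_inv_sq_sum R (2 ^ n)
    <= pi ^+ 2 / 8.
Proof.
have := sum_inv_sq_sin R n.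
move: (2 ^ n)%N (expn_gt0 2 n) => m m0 e.
have m0R : 0 < m%:R :> R by rewrite ltr0n.
have p0 := pi_gt0 R.
pose a : R := pi / (4 * m%:R).
have a0 : 0 < a by rewrite divr_gt0 // mulr_gt0.
have B k : (k < m)%N -> (k.*2.+1%:R * a) ^- 2 <= sin (k.*2.+1%:R * a) ^- 2
    <= (k.*2.+1%:R * a) ^- 2 + 1.
  move=> km; apply: inv_sq_sin_bounds; first by rewrite mulr_gt0.
  have -> : pi / 2 = m.*2%:R * a.
    by rewrite /a -muln2 natrM; field; rewrite gt_eqF.
  by rewrite ltr_pM2r // ltr_nat; lia.
have E : \sum_(0 <= k < m) (k.*2.+1%:R * a) ^- 2 = a ^- 2 * odd_inv_sq_sum m.
  rewrite /odd_inv_sq_sum mulr_sumr; apply: eq_bigr => k _.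
  by rewrite exprMn invfM mulrC.
have L : a ^- 2 * odd_inv_sq_sum m <= 2 * m%:R ^+ 2.
  rewrite -e -E big_nat [leRHS]big_nat.
  by apply: ler_sum => k /= km; have /andP[] := B k km.
have U : 2 * m%:R ^+ 2 <= a ^- 2 * odd_inv_sq_sum m + m%:R.
  have mE : \sum_(0 <= k < m) 1 = m%:R :> R by rewrite sumr_const_nat subn0.
  rewrite -e -E -[X in _ + X]mE -big_split /= big_nat [leRHS]big_nat.
  by apply: ler_sum => k /= km; have /andP[] := B k km.
have A : a ^+ 2 * m%:R ^+ 2 = pi ^+ 2 / 16 by rewrite /a; field; rewrite gt_eqF.
have aV : a ^+ 2 * a ^- 2 = 1 by rewrite divff // sqrf_eq0 gt_eqF.
have mV : m%:R ^+ 2 * m%:R ^-1 = m%:R :> R by rewrite expr2 mulfK // gt_eqF.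
have a2 : 0 < a ^+ 2 by rewrite exprn_gt0.
have O : a ^+ 2 * (a ^- 2 * odd_inv_sq_sum m) = odd_inv_sq_sum m.
  by rewrite mulrA aV mul1r.
have M : a ^+ 2 * (2 * m%:R ^+ 2) = pi ^+ 2 / 8 by rewrite mulrCA A; field.
have := ler_wpM2l (ltW a2) L; rewrite O M => {}L.
have := ler_wpM2l (ltW a2) U.
rewrite M mulrDr O -[X in _ + a ^+ 2 * X]mV mulrA A => {}U.
by apply/andP; split; [lra | exact: L].
Qed.

(** Split by parity: the even terms form a quarter of [inv_sq_sum n]. *)
Lemma inv_sq_sum_double (R : realType) (n : nat) :
  inv_sq_sum (n + n) = odd_inv_sq_sum n + inv_sq_sum n / 4 :> R.
Proof.
elim: n => [|n IH].
  by rewrite /inv_sq_sum /odd_inv_sq_sum !big_geq // mul0r addr0.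
rewrite addSn addnS !inv_sq_sumS IH /odd_inv_sq_sum big_nat_recr //= addnn.
have -> : n.*2.+2%:R = 2 * n.+1%:R :> R by rewrite -doubleS -mul2n natrM.
have n1 : n.+1%:R != 0 :> R by rewrite pnatr_eq0.
have n2 : n.*2.+1%:R != 0 :> R by rewrite pnatr_eq0.
move: n.+1%:R n.*2.+1%:R n1 n2 => x y x0 y0.
by field; rewrite x0 y0.
Qed.

Lemma inv_sq_sum_le2 (R : realType) (n : nat) : inv_sq_sum n <= 2 :> R.
Proof.
case: n => [|n]; first by rewrite /inv_sq_sum big_geq.
(* Strengthened for the induction: [1 / k^2 <= 1 / (k - 1) - 1 / k] telescopes. *)
apply: (@le_trans _ _ (2 - n.+1%:R^-1)); last by rewrite gerBl.
elim: n => [|n IH]; first by rewrite /inv_sq_sum big_nat1 expr1n invr1; lra.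
rewrite inv_sq_sumS.
suff h : n.+2%:R ^- 2 <= n.+1%:R^-1 - n.+2%:R^-1 :> R.
  by apply: le_trans (lerD IH h) _; rewrite addrA subrK.
rewrite -[n.+2%:R]natr1; set x := n.+1%:R.
have x0 : 0 < x by rewrite ltr0n.
have -> : x^-1 - (x + 1)^-1 = (x * (x + 1))^-1.
  by field; rewrite !gt_eqF // addr_gt0.
rewrite lef_pV2 ?posrE ?exprn_gt0 ?mulr_gt0 ?addr_gt0 //.
by rewrite expr2 ler_pM2r ?lerDl // addr_gt0.
Qed.

(** A limit [z] exists by monotonicity and boundedness. Along [2^n] the parity split sends the odd
    sums to [z - z / 4], while the sine bounds send them to [pi^2 / 8]. *)
Lemma cvg_inv_sq_sum (R : realType) : @inv_sq_sum R @ \oo --> (pi ^+ 2 / 6 : R).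
Proof.
have cv : cvgn (@inv_sq_sum R).
  apply: nondecreasing_is_cvgn; last first.
    by exists 2 => _ [n _ <-]; exact: inv_sq_sum_le2.
  apply/nondecreasing_seqP => n.
  by rewrite inv_sq_sumS lerDl invr_ge0 exprn_ge0.
set z := lim (@inv_sq_sum R @ \oo); have sz : @inv_sq_sum R @ \oo --> z by [].
have pow_oo : (fun n => 2 ^ n)%N @ \oo --> \oo.
  apply/cvgnyPge => A; exists A => // n /= An.
  exact: leq_trans An (ltnW (ltn_expl _ _)).
have s1 : inv_sq_sum (2 ^ n) @[n --> \oo] --> z := cvg_comp _ _ pow_oo sz.
have s2 : inv_sq_sum (2 ^ n + 2 ^ n) @[n --> \oo] --> z.
  have : inv_sq_sum (2 ^ n.+1) @[n --> \oo] --> z.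
    by rewrite (@cvg_shiftS _ (fun n => inv_sq_sum (2 ^ n)%N)).
  by under eq_fun do rewrite expnS mul2n -addnn.
have o1 : odd_inv_sq_sum (2 ^ n) @[n --> \oo] --> z - z / 4.
  have -> : (fun n => odd_inv_sq_sum (2 ^ n) : R) =
      (fun n => inv_sq_sum (2 ^ n + 2 ^ n) - inv_sq_sum (2 ^ n) / 4).
    by apply/funext => n; rewrite inv_sq_sum_double addrK.
  by apply: cvgB s2 _; apply: cvgM s1 _; exact: cvg_cst.
have o2 : odd_inv_sq_sum (2 ^ n) @[n --> \oo] --> (pi ^+ 2 / 8 : R).
  apply: (@squeeze_cvgr _ _ _ _
    (fun n => pi ^+ 2 / 8 - pi ^+ 2 / 16 * (2 ^ n)%:R^-1)
    (fun=> pi ^+ 2 / 8)); [ | |exact: cvg_cst].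
    by apply: nearW => n; exact: odd_inv_sq_sum_bounds.
  rewrite -[X in _ --> X]subr0 -[X in _ - X](mulr0 (pi ^+ 2 / 16)).
  apply: cvgB; first exact: cvg_cst.
  apply: cvgM; first exact: cvg_cst.
  under eq_fun do rewrite natrX -exprVn.
  apply: cvg_expr; rewrite ger0_norm ?invr_ge0 //.
  by rewrite invf_lt1 // ltr1n.
have zE := cvg_unique (@Rhausdorff R) o1 o2.
rewrite (_ : pi ^+ 2 / 6 = z) //.
rewrite [RHS](_ : _ = (z - z / 4) * (4 / 3)); last by field.
by rewrite zE; field.
Qed.

(** * Hitting probabilities *)

Lemma HD_transE (R : realType) (n k : nat) : (1 <= k < n.+2)%N ->
  HD_trans n.+2 k = (n.+2 - k)%:R^-1 / harm n.+1 :> R.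
Proof. by move=> kn; rewrite /HD_trans /= kn invfM. Qed.

Lemma HD_trans_sum1 (R : realType) (j : nat) : (1 < j)%N ->
  \sum_(1 <= k < j) HD_trans j k = 1 :> R.
Proof.
case: j => [|[|n]] // _; rewrite big_nat.
under eq_bigr => k kn do rewrite HD_transE //.
by rewrite -big_nat -mulr_suml harm_rev divff // gt_eqF // harm_gt0.
Qed.

(* First-step analysis for [a(j, i)]; junk unless the fuel [f] exceeds [j]. *)
Fixpoint hit_fuel {R : realType} (i f j : nat) : R :=
  if f is f'.+1 then
    if (j <= i)%N then (j == i)%:R
    else \sum_(1 <= k < j) HD_trans j k * hit_fuel i f' k
  else 0.

Definition hit_val {R : realType} (i j : nat) : R := hit_fuel i j.+1 j.

Lemma hit_fuelE (R : realType) (i f j : nat) : (j < f)%N ->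
  hit_fuel i f j = hit_val i j :> R.
Proof.
suff H k f1 f2 : (k < f1)%N -> (k < f2)%N ->
  hit_fuel i f1 k = hit_fuel i f2 k :> R by move=> jf; exact: H.
elim/ltn_ind: k f1 f2 => {}j IH [|f1] [|f2] //= jf1 jf2.
case: ifP => // _; rewrite big_nat [RHS]big_nat.
apply: eq_bigr => k /andP[_ kj]; congr (_ * _).
by apply: IH => //; exact: leq_trans kj _.
Qed.

Lemma hit_val_le (R : realType) (i j : nat) : (j <= i)%N ->
  hit_val i j = (j == i)%:R :> R.
Proof. by move=> ji; rewrite /hit_val /= ji. Qed.

Lemma hit_val_gt (R : realType) (i j : nat) : (i < j)%N ->
  hit_val i j = \sum_(1 <= k < j) HD_trans j k * hit_val i k :> R.
Proof.
move=> ij; rewrite {1}/hit_val /= leqNgt ij /= big_nat [RHS]big_nat.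
by apply: eq_bigr => k /andP[_ kj]; rewrite hit_fuelE.
Qed.

(** Below [i] both sides are 0, so the recursion holds at every state but [i]; [no_hit_lower] also
    uses it below [i]. *)
Lemma hit_val_harmonic (R : realType) (i j : nat) : j != i ->
  hit_val i j = \sum_(1 <= k < j) HD_trans j k * hit_val i k :> R.
Proof.
move=> ji; have [le_ji|/hit_val_gt//] := leqP j i.
rewrite hit_val_le // (negbTE ji) big_nat big1 // => k /andP[_ kj].
have ki := leq_trans kj le_ji.
by rewrite hit_val_le ?(ltnW ki) // (ltn_eqF ki) mulr0.
Qed.

(** * Path events of the chain *)

Lemma fine_prob_le (R : realType) (d : measure_display) (T : measurableType d)
    (P : probability T R) (A B : set T) :
  measurable A -> measurable B -> A `<=` B -> fine (P A) <= fine (P B).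
Proof.
move=> mA mB AB; apply: fine_le; rewrite ?fin_num_measure //.
by rewrite le_measure ?inE.
Qed.

Lemma measurable_state (R : realType) (d : measure_display)
    (T : measurableType d) (P : probability T R) (X : {RV P >-> nat})
    (j : nat) :
  measurable [set w | X w = j].
Proof. exact: (@measurable_funPTI _ _ _ _ X [set j]). Qed.

Lemma path_eventS (d : measure_display) (T : measurableType d)
    (X : nat -> T -> nat) (x : nat -> nat) (t : nat) :
  path_event X x t.+1 = [set w | X t.+1 w = x t.+1] `&` path_event X x t.
Proof.
apply/seteqP; split=> w /=.
  by move=> h; split=> [|s st]; apply: h => //; exact: leqW.
by move=> [h1 h] s; rewrite leq_eqVlt => /predU1P[->//|]; exact: h.
Qed.

Lemma eq_path_event (d : measure_display) (T : measurableType d)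
    (X : nat -> T -> nat) (x y : nat -> nat) (t : nat) :
  (forall s, (s <= t)%N -> x s = y s) -> path_event X x t = path_event X y t.
Proof.
move=> xy; apply/seteqP; split=> w /= h s st; first by rewrite -xy ?h.
by rewrite xy ?h.
Qed.

Lemma measurable_path_event (R : realType) (d : measure_display)
    (T : measurableType d) (P : probability T R) (X : nat -> {RV P >-> nat})
    (x : nat -> nat) (t : nat) : measurable (path_event X x t).
Proof.
elim: t => [|t IH]; last first.
  by rewrite path_eventS; apply: measurableI => //; exact: measurable_state.
rewrite (_ : path_event _ _ _ = [set w | X 0%N w = x 0%N]).
  exact: measurable_state.
by apply/seteqP; split=> w /= h => [|s]; [exact: h | rewrite leqn0 => /eqP ->].
Qed.

Lemma path_event_step (R : realType) (d : measure_display)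
    (T : measurableType d) (P : probability T R) (p : nat -> nat -> R) (n : nat)
    (X : nat -> {RV P >-> nat}) (x : nat -> nat) (t : nat) :
  markov_chain p n X ->
  fine (P (path_event X x t.+1)) =
    fine (P (path_event X x t)) * p (x t) (x t.+1).
Proof.
move=> hX; have mC s := measurable_path_event R d T P X x s.
(* On a null path [mc_step] says nothing, but the longer path event is contained in it, so both
   sides are 0. *)
have [C0|C0] := eqVneq (P (path_event X x t)) 0%E.
  rewrite C0 mul0r; apply/le_anti; rewrite fine_ge0 // andbT.
  rewrite -[leRHS]/(fine 0%E) -C0 fine_prob_le //.
  by rewrite path_eventS; exact: subIsetr.
have := mc_step hX (x t.+1) C0; rewrite /cond_prob -path_eventS => <-.
by rewrite mulrC divfK // fine_eq0 // fin_num_measure.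
Qed.

(** Constant after [t], so that it serves both for one further step and, with [y = 1], for
    absorption forever. *)
Definition extend_path (x : nat -> nat) (t y : nat) : nat -> nat :=
  fun s => if (s <= t)%N then x s else y.

Lemma extend_pathS (x : nat -> nat) (t y : nat) : extend_path x t y t.+1 = y.
Proof. by rewrite /extend_path ltnn. Qed.

(** The one-step extensions are disjoint parts of the path event. An inequality suffices, as it is
    used for lower bounds on both hitting and missing [i]. *)
Lemma path_event_extend_sum (R : realType) (d : measure_display)
    (T : measurableType d) (P : probability T R) (X : nat -> {RV P >-> nat})
    (x : nat -> nat) (t m : nat) (H : set T) : measurable H ->
  \sum_(1 <= y < m) fine (P (path_event X (extend_path x t y) t.+1 `&` H))
    <= fine (P (path_event X x t `&` H)).
Proof.
move=> mH; rewrite big_add1 big_mkord.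
pose F y := path_event X (extend_path x t y.+1) t.+1 `&` H.
have mF y : measurable (F y).
  by apply: measurableI => //; exact: measurable_path_event.
have tF : trivIset setT F.
  move=> y z _ _ [w [[]]]; rewrite /F path_eventS /= => -[/= hy _] _ [].
  rewrite path_eventS => -[/= hz _] _; move: hy.
  by rewrite hz /extend_path ltnn => -[].
have sF : \big[setU/set0]_(y < m.-1) F y `<=` path_event X x t `&` H.
  rewrite -bigcup_mkord => w [y _] []; rewrite path_eventS => -[_ h] Hw.
  by split=> // s st; rewrite h // /extend_path st.
have <- : fine (P (\big[setU/set0]_(y < m.-1) F y)) =
    \sum_(y < m.-1) fine (P (F y)).
  rewrite measure_bigsetU // (eq_bigr (fun y : 'I__ => (fine (P (F y)))%:E)).
    by rewrite sumEFin.
  by move=> y _; rewrite fineK ?fin_num_measure.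
apply: fine_prob_le => //.
  by apply: bigsetU_measurable.
by apply: measurableI => //; exact: measurable_path_event.
Qed.

(** Common induction step of [hit_lower] and [no_hit_lower]: a lower bound on all one-step
    extensions passes to the path when [g] is harmonic at its endpoint. *)
Lemma HD_first_step (R : realType) (d : measure_display)
    (T : measurableType d) (P : probability T R) (n : nat)
    (X : nat -> {RV P >-> nat}) (x : nat -> nat) (t : nat) (H : set T)
    (g : nat -> R) :
  markov_chain (@HD_trans R) n X -> measurable H ->
  g (x t) = \sum_(1 <= k < x t) HD_trans (x t) k * g k ->
  (forall k, (1 <= k < x t)%N ->
    g k * fine (P (path_event X (extend_path x t k) t.+1))
      <= fine (P (path_event X (extend_path x t k) t.+1 `&` H))) ->
  g (x t) * fine (P (path_event X x t)) <= fine (P (path_event X x t `&` H)).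
Proof.
move=> hX mH -> hk.
apply: le_trans (path_event_extend_sum R d T P X x t (x t) H mH).
rewrite mulr_suml big_nat [leRHS]big_nat; apply: ler_sum => k /hk.
apply: le_trans; rewrite (path_event_step _ _ _ _ _ _ _ _ _ hX).
rewrite {2 3}/extend_path leqnn ltnn.
rewrite (@eq_path_event _ _ _ (extend_path x t k) x).
  by rewrite mulrAC [leRHS]mulrC [X in _ <= X * _]mulrC.
by move=> s st; rewrite /extend_path st.
Qed.

Lemma measurable_hit (R : realType) (d : measure_display)
    (T : measurableType d) (P : probability T R) (X : nat -> {RV P >-> nat})
    (i : nat) : measurable [set w | exists t, X t w = i].
Proof.
rewrite (_ : [set w | _] = \bigcup_t [set w | X t w = i]).
  by apply: bigcup_measurable => t _; exact: measurable_state.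
by apply/seteqP; split=> w /= [t]; [exists t | move=> _; exists t].
Qed.

(** Strong induction on the current state, since steps from states above [i] go strictly down; at or
    below [i] the bound is immediate. *)
Lemma hit_lower (R : realType) (d : measure_display)
    (T : measurableType d) (P : probability T R) (n i : nat)
    (X : nat -> {RV P >-> nat}) (x : nat -> nat) (t : nat) :
  markov_chain (@HD_trans R) n X ->
  hit_val i (x t) * fine (P (path_event X x t))
    <= fine (P (path_event X x t `&` [set w | exists s, X s w = i])).
Proof.
move=> hX; have mH := measurable_hit R d T P X i.
move: {2}(x t) (erefl (x t)) => j; elim/ltn_ind: j x t => j IH x t xt.
have [ji|ij|ji] := ltngtP (x t) i.
- by rewrite hit_val_le ?(ltnW ji) // (ltn_eqF ji) mul0r fine_ge0.
- apply: (HD_first_step R d T P n X x t _ (hit_val i) hX mH).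
    exact: hit_val_gt.
  move=> k /andP[_ kj].
  by have := IH k _ _ _ (extend_pathS x t k); rewrite extend_pathS -xt; apply.
- rewrite hit_val_le ji // eqxx mul1r; apply: fine_prob_le.
  + exact: measurable_path_event.
  + by apply: measurableI => //; exact: measurable_path_event.
  + by move=> w h; split=> //; exists t; rewrite h.
Qed.

(** Each further step at 1 has probability 1, and continuity from above passes to the infinite
    stay. *)
Lemma path_event_absorbed (R : realType) (d : measure_display)
    (T : measurableType d) (P : probability T R) (n : nat)
    (X : nat -> {RV P >-> nat}) (x : nat -> nat) (t : nat) :
  markov_chain (@HD_trans R) n X -> x t = 1%N ->
  P (\bigcap_m path_event X (extend_path x t 1) (t + m)) = P (path_event X x t).
Proof.
move=> hX xt; pose F m := path_event X (extend_path x t 1) (t + m).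
have mF m : measurable (F m) by exact: measurable_path_event.
have PF m : P (F m) = P (path_event X x t).
  have mC := measurable_path_event R d T P X x t.
  rewrite -[LHS]fineK ?fin_num_measure // -[RHS]fineK ?fin_num_measure //.
  congr (_%:E); elim: m => [|m IH].
    rewrite /F addn0; congr (fine (P _)); apply: eq_path_event => s st.
    by rewrite /extend_path st.
  rewrite -IH /F addnS (path_event_step _ _ _ _ _ _ _ _ _ hX).
  rewrite [X in HD_trans X](_ : _ = 1%N); last first.
    rewrite /extend_path; case: ifP => // tm.
    by rewrite (_ : t + m = t)%N //; lia.
  by rewrite /extend_path leqNgt ltnS leq_addr /= mulr1.
have : P (F m) @[m --> \oo] --> P (\bigcap_m F m).
  apply: nonincreasing_cvg_mu => //.
  - by rewrite ltey_eq fin_num_measure.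
  - exact: bigcap_measurableType.
  - apply/nonincreasing_seqP => m; apply/subsetPset.
    by rewrite /F addnS path_eventS; exact: subIsetr.
rewrite (_ : (fun m => P (F m)) = fun=> P (path_event X x t)); last first.
  exact/funext.
by move=> /cvg_lim <- //; rewrite lim_cst.
Qed.

(** The same induction for the complementary event, run down to the absorbing state 1, where a path
    that has avoided [i] avoids it forever. *)
Lemma no_hit_lower (R : realType) (d : measure_display)
    (T : measurableType d) (P : probability T R) (n i : nat)
    (X : nat -> {RV P >-> nat}) (x : nat -> nat) (t : nat) :
  (2 <= i)%N -> markov_chain (@HD_trans R) n X ->
  (forall s, (s < t)%N -> x s != i) ->
  (1 - hit_val i (x t)) * fine (P (path_event X x t))
    <= fine (P (path_event X x t `&` ~` [set w | exists s, X s w = i])).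
Proof.
move=> i2 hX; have mH := measurableC (measurable_hit R d T P X i).
move: {2}(x t) (erefl (x t)) => j; elim/ltn_ind: j x t => j IH x t xt xi.
have [ji|ji] := eqVneq (x t) i.
  by rewrite hit_val_le ji // eqxx subrr mul0r fine_ge0.
have mC s y := measurable_path_event R d T P X y s.
have [j2|j1] := ltnP 1 (x t).
  apply: (HD_first_step R d T P n X x t _ (fun k => 1 - hit_val i k) hX mH).
    (* The constant 1 is harmonic because the transitions sum to 1, hence so is [1 - hit_val] off
       [i]. *)
    under eq_bigr do rewrite mulrBr mulr1.
    by rewrite sumrB HD_trans_sum1 // -hit_val_harmonic.
  move=> k /andP[_ kj].
  have := IH k _ _ _ (extend_pathS x t k); rewrite extend_pathS -xt.
  apply=> // s.
  rewrite /extend_path ltnS => st; rewrite st.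
  by move: st; rewrite leq_eqVlt => /predU1P[->|/xi].
have [xt0|xt0] := posnP (x t).
  rewrite (_ : path_event X x t = set0); first by rewrite set0I measure0 mulr0.
  apply/seteqP; split=> // w /(_ t (leqnn t)).
  by rewrite xt0 => h; have := mc_state hX t w; rewrite h.
have xt1 : x t = 1%N by apply/eqP; rewrite eqn_leq j1.
rewrite xt1 hit_val_le ?(ltnW i2) // (ltn_eqF i2) subr0 mul1r.
rewrite -(path_event_absorbed _ _ _ _ _ _ _ _ hX xt1); apply: fine_prob_le.
- by apply: bigcap_measurableType => m _.
- exact: measurableI.
(* Up to time [t] the path avoids [i] by [xi] and [ji]; afterwards it stays at 1, which differs from
   [i]. *)
- move=> w h; split.
    move=> s st; rewrite (h t I) ?(leq_trans st) ?leq_addr //.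
    by rewrite /extend_path st.
  move=> [s]; rewrite (h s I) ?leq_addl // /extend_path; case: ifP => [|_ i1].
    by rewrite leq_eqVlt => /predU1P[->|/xi/eqP//]; move/eqP: ji.
  by rewrite -i1 in i2.
Qed.

(** The lower bounds for hitting and for missing [i] add up to 1 on the almost sure path of length
    0, so both are equalities. *)
Lemma hit_probE (R : realType) (d : measure_display)
    (T : measurableType d) (P : probability T R) (n i : nat)
    (X : nat -> {RV P >-> nat}) :
  (2 <= i)%N -> markov_chain (@HD_trans R) n X ->
  hit_prob P X i = hit_val i n.
Proof.
move=> i2 hX; have mH := measurable_hit R d T P X i.
have mC := measurable_path_event R d T P X (fun=> n) 0.
have C1 : fine (P (path_event X (fun=> n) 0)) = 1.
  rewrite (_ : path_event _ _ _ = [set w | X 0%N w = n]) ?(mc_start hX) //.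
  apply/seteqP; split=> w /= h => [|s]; first exact: h.
  by rewrite leqn0 => /eqP ->.
have := hit_lower R d T P n i X (fun=> n) 0 hX.
have := no_hit_lower R d T P n i X (fun=> n) 0 i2 hX (fun s => ltac:(by [])).
rewrite C1 !mulr1 => lo up; apply/le_anti/andP; split.
  have : fine (P (~` [set w | exists s, X s w = i])) = 1 - hit_prob P X i.
    by rewrite probability_setC // fineB ?fin_num_measure.
  suff : 1 - hit_val i n <= fine (P (~` [set w | exists s, X s w = i])).
    by move=> h1 h2; rewrite h2 in h1; lra.
  apply: (le_trans lo); apply: fine_prob_le; last exact: subIsetr.
    by apply: measurableI => //; exact: measurableC.
  exact: measurableC.
by apply: (le_trans up); apply: fine_prob_le => //; exact: measurableI.
Qed.

(** * Averaging and flux of the hitting probabilities *)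

Lemma hit_val_bounds (R : realType) (i j : nat) : 0 <= @hit_val R i j <= 1.
Proof.
elim/ltn_ind: j => j IH; have [ji|ij] := leqP j i.
  by rewrite hit_val_le //; case: eqP; rewrite ?lexx ?ler01.
case: j ij IH => [//|[|j] ij IH].
  by rewrite hit_val_gt // big_geq // lexx ler01.
have p0 k : (1 <= k < j.+2)%N -> 0 <= HD_trans j.+2 k :> R.
  by move=> kj; rewrite HD_transE // divr_ge0 ?invr_ge0 // ltW // harm_gt0.
rewrite hit_val_gt // big_nat; apply/andP; split.
  apply: sumr_ge0 => k kj; rewrite mulr_ge0 ?p0 //.
  by have /andP[_ /IH/andP[]] := kj.
rewrite -[leRHS](@HD_trans_sum1 R j.+2) // [leRHS]big_nat.
apply: ler_sum => k kj.
by rewrite ler_piMr ?p0 //; have /andP[_ /IH/andP[]] := kj.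
Qed.

Lemma hit_val_average (R : realType) (i x : nat) : (i <= x)%N -> (0 < x)%N ->
  harm x * hit_val i x.+1 = \sum_(0 <= y < x) hit_val i y.+1 / (x - y)%:R :> R.
Proof.
case: x => // x ix _; rewrite hit_val_gt // big_nat mulr_sumr.
rewrite [RHS](_ : _ = \sum_(1 <= y < x.+2) hit_val i y / (x.+2 - y)%:R).
  2: by rewrite [RHS]big_add1.
rewrite [RHS]big_nat; apply: eq_bigr => k kx; rewrite HD_transE //.
have h0 : harm x.+1 != 0 :> R by rewrite gt_eqF // harm_gt0.
by rewrite mulrA mulrCA mulfV // mulr1 mulrC.
Qed.

(** At [x = i - 1] only the term of state [i] survives, with weight [harm x / x]; averaging above
    [i] then conserves the flux. *)
Lemma hit_val_flux (R : realType) (i x : nat) : (2 <= i)%N -> (i.-1 <= x)%N ->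
  flux (fun y => hit_val i y.+1) x = harm i.-1 / i.-1%:R :> R.
Proof.
case: i => // i i1 /=; rewrite ltnS in i1.
elim: x => [|x IH]; first by rewrite leqn0 => /eqP i0; rewrite i0 in i1.
rewrite leq_eqVlt => /predU1P[->|ix]; last first.
  (* The flux starts at index 1 and the averaging sum at 0; the extra term is [hit_val i 1 = 0]. *)
  rewrite fluxS IH // hit_val_average // big_ltn //.
  rewrite (hit_val_le R i.+1 1) // eqSS (ltn_eqF i1).
  by rewrite mul0r add0r subrr mulr0 addr0.
rewrite /flux big_nat_recr //= big_nat big1 => [|r /andP[_ rx]]; last first.
  by rewrite hit_val_le ?ltnS 1?ltnW // eqSS (ltn_eqF rx) mulr0.
by rewrite add0r hit_val_le // eqxx mulr1 /flux_weight subnn harm0 subr0.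
Qed.

Lemma hit_val_cvg (R : realType) (i : nat) : (2 <= i)%N ->
  @hit_val R i @ \oo --> (6 * harm i.-1 / (pi ^+ 2 * i.-1%:R) : R).
Proof.
(* The flux indexes state [r + 1] by [r], so the sequence is shifted by one. *)
move=> i2; rewrite -cvg_shiftS.
have i1 : i.-1%:R != 0 :> R by rewrite pnatr_eq0; case: i i2 => [|[]].
have p0 : pi != 0 :> R by rewrite gt_eqF // pi_gt0.
have -> : 6 * harm i.-1 / (pi ^+ 2 * i.-1%:R) =
    (harm i.-1 / i.-1%:R) / (pi ^+ 2 / 6) :> R.
  by move: pi p0 => p p0; field; rewrite p0 i1.
apply: (flux_cvg _ _ _ _ i.-1 (cvg_inv_sq_sum R)).
- by rewrite divr_gt0 // exprn_gt0 // pi_gt0.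
- exists 1 => x; have /andP[h0 h1] := hit_val_bounds R i x.+1.
  by rewrite ger0_norm.
- by move=> x; exact: hit_val_flux.
- move=> x ix; have x0 : (0 < x)%N by exact: leq_ltn_trans ix.
  have ix' : (i <= x)%N by case: i ix {i2 i1}.
  under eq_bigr do rewrite mulrBl.
  rewrite sumrB -hit_val_average // -mulr_sumr mulrC.
  rewrite [X in X * _](_ : _ = harm x) ?subrr //.
  by case: x x0 {ix ix'} => // x _; rewrite -harm_rev [RHS]big_add1.
Qed.

Theorem theorem1p1 (R : realType)
  (d : nat -> measure_display) (T : forall n : nat, measurableType (d n))
  (P : forall n : nat, probability (T n) R)
  (X : forall n : nat, nat -> {RV (P n) >-> nat})
  (hX : forall n : nat, (1 <= n)%N -> markov_chain (@HD_trans R) n (X n))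
  (i : nat) (hi : (2 <= i)%N) :
  hit_prob (P n) (X n) i @[n --> \oo] -->
    (6 * harm i.-1 / (pi ^+ 2 * i.-1%:R) : R).
Proof.
apply: cvg_trans (hit_val_cvg R i hi); apply: near_eq_cvg.
by exists 1%N => // n n1; rewrite (hit_probE _ _ _ _ n _ _ hi (hX n n1)).
Qed.
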